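(* The Filter Dichotomy implies that there are no medial limits. That is: suppose that for every uniform nonmeager filter $F$ on $\omega$ there is a finite-to-one function $h \colon \omega \to \omega$ such that $\{ h[x] \mid x \in F\}$ is an ultrafilter on $\omega$. Then there is no universally measurable function $f \colon \mathcal{P}(\omega) \to [0,1]$ which is finitely additive for disjoint sets and satisfies $f(\{n\}) = 0$ for all $n \in \omega$ and $f(\omega) = 1$.
   Context: $\mathcal{P}(\omega)$ carries its usual (Cantor space) topology, identifying subsets of $\omega$ with elements of $2^{\omega}$; meagerness of a set of subsets of $\omega$ refers to this topology. Filters on $\omega$ are proper (do not contain $\emptyset$). A filter on $\omega$ is uniform if it contains all cofinite subsets of $\omega$. A function $h\colon \omega\to\omega$ is finite-to-one if $h^{-1}[\{n\}]$ is finite for every $n$; $h[x]$ denotes the image $\{h(m) \mid m \in x\}$. A Borel measure on a topological space is a countably additive measure (with values in $[0,\infty]$) whose domain is a $\sigma$-algebra containing the Borel sets; it is complete if all subsets of sets of measure $0$ are in its domain. A subset of a topological space is universally measurable if it is measurable with respect to (i.e., in the domain of) every complete $\sigma$-finite Borel measure on the space. A function between topological spaces is universally measurable if all preimages of open sets are universally measurable. The Filter Dichotomy is the statement: for every uniform nonmeager filter $F$ on $\omega$ there is a finite-to-one $h\colon\omega\to\omega$ such that $\{h[x] \mid x \in F\}$ is an ultrafilter on $\omega$. A medial limit is a universally measurable function $f\colon \mathcal{P}(\omega)\to[0,1]$ which is finitely additive for disjoint sets, maps singletons to $0$, and maps $\omega$ to $1$. *)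

(* Defs.v *)
From HB Require Import structures.
From mathcomp Require Import all_boot all_order all_algebra.
From mathcomp Require Import all_classical all_reals all_analysis.
Import numFieldNormedType.Exports.

Set Implicit Arguments.
Unset Strict Implicit.
Unset Printing Implicit Defensive.

Import Order.TTheory GRing.Theory Num.Theory.

Local Open Scope classical_set_scope.
Local Open Scope ring_scope.

Definition char_fun (A : set nat) : cantor_space := fun n => `[< A n >].

(* [set nat] with the topology transported from the Cantor space along the
   bijection [char_fun]. *)
Definition powerset_omega : Type := initial_topology char_fun.

HB.instance Definition _ := Pointed.on powerset_omega.
HB.instance Definition _ := Topological.on powerset_omega.

Definition nowhere_dense (T : topologicalType) (A : set T) : Prop :=
  interior (closure A) = set0.

Definition meager (T : topologicalType) (A : set T) : Prop :=
  exists2 N : nat -> set T,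
    forall n, nowhere_dense (N n) & A = \bigcup_n N n.

(* The measures range over all sigma-algebras [S] containing the open (hence
   the Borel) sets; since [S] is a sigma-algebra, the measurable sets of
   [g_sigma_algebraType S] are exactly the members of [S]. *)
Definition universally_measurable (R : realType) (T : ptopologicalType)
    (A : set T) : Prop :=
  forall (S : set_system T) (mu : {measure set (g_sigma_algebraType S) -> \bar R}),
    sigma_algebra setT S ->
    open `<=` S ->
    measure_is_complete mu ->
    sigma_finite setT mu ->
    S A.

Definition universally_measurable_fun (R : realType) (T : ptopologicalType)
    (U : topologicalType) (f : T -> U) : Prop :=
  forall V : set U, open V -> universally_measurable R (f @^-1` V).

Definition uniform_filter (F : set_system nat) : Prop :=
  ProperFilter F /\ @frechet_filter nat `<=` F.

Definition finite_to_one (h : nat -> nat) : Prop :=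
  forall n, finite_set (h @^-1` [set n]).

Definition filter_dichotomy : Prop :=
  forall F : set_system nat,
    uniform_filter F -> ~ meager (F : set powerset_omega) ->
    exists2 h : nat -> nat,
      finite_to_one h & UltraFilter [set h @` x | x in F].

(* A map into [0, 1] is rendered as an [R]-valued map with bounds: the open sets
   of [0, 1] are the traces of those of [R], so the preimages are the same. *)
Definition medial_limit (R : realType) (f : powerset_omega -> R) : Prop :=
  [/\ forall A, 0 <= f A <= 1,
      universally_measurable_fun R f,
      forall A B : set nat, A `&` B = set0 -> f (A `|` B) = f A + f B,
      forall n : nat, f [set n] = 0 &
      f [set: nat] = 1].

(* Main.v *)
From HB Require Import structures.
Require Import Defs.
From mathcomp Require Import all_boot all_order all_algebra.
From mathcomp Require Import all_classical all_reals all_analysis.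
From mathcomp Require Import zify lra.
Import numFieldNormedType.Exports.

Set Implicit Arguments.
Unset Strict Implicit.
Unset Printing Implicit Defensive.

Import Order.TTheory GRing.Theory Num.Theory.

Local Open Scope classical_set_scope.
Local Open Scope ring_scope.

(** A medial limit [f] is in particular a finitely additive probability on the
    subsets of omega that vanishes on singletons; let [F] be the uniform filter
    of the sets of [f]-value 1. The proof has two halves.

    The filter [F] is never meager, by finite additivity alone. If an upward
    closed family is meager, then omega can be cut into finite blocks such that
    no member of the family misses infinitely many blocks
    ([meager_upclosed_blocks]). For [F] this says that the union of any
    infinite set of blocks has positive [f]-value. But giving a set of
    blocks the [f]-value of its union defines again a finitely additive measure
    that vanishes on singletons, and each such measure vanishes on some infinite
    set ([exists_infinite_charge0]).

    Hence the Filter Dichotomy provides a finite-to-one [h] for which the image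
    of [F] is an ultrafilter; it consists of the sets whose preimage under [h]
    has [f]-value 1, so it is nonprincipal. Reading the binary digits of a
    real number as a subset of omega pulls this ultrafilter back to a set [E] of
    reals. Universal measurability of [f], tested on images of Lebesgue measure,
    makes [E] Lebesgue measurable ([universally_measurable_preimage]). This
    contradicts a theorem of Sierpinski ([ultrafilter_nonmeasurable]):
    reflecting an interval with dyadic endpoints about its midpoint complements
    all but finitely many binary digits of each number that is not dyadic, so up
    to a countable set it exchanges [E] with its complement. Thus [E] fills
    exactly half of every interval, whereas a measurable set that fills at most
    half of every interval is null. *)

(** * Finitely additive measures on the natural numbers *)

Section diffuse_charge.
Variable R : realType.
Implicit Types (g : set nat -> R) (A B : set nat).

Definition diffuse_charge g :=
  [/\ forall A, 0 <= g A,
      forall A B, A `&` B = set0 -> g (A `|` B) = g A + g B &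
      forall n, g [set n] = 0].

Lemma charge0 g : diffuse_charge g -> g set0 = 0.
Proof.
move=> [_ gU _]; have := gU set0 set0 (set0I _); rewrite setU0 => /eqP.
by rewrite -subr_eq subrr => /eqP.
Qed.

Lemma charge_le g A B : diffuse_charge g -> A `<=` B -> g A <= g B.
Proof.
move=> [g0 gU _] AB; rewrite -(setDUK AB).
by rewrite gU ?lerDl// setDIK.
Qed.

Lemma charge_leU g A B : diffuse_charge g -> g (A `|` B) <= g A + g B.
Proof.
move=> cg; have [_ gU _] := cg.
have -> : A `|` B = A `|` (B `\` A).
  by apply/seteqP; split=> n /=; have [] := pselect (A n); tauto.
rewrite gU ?setDIK// lerD2l; exact/charge_le.
Qed.

Lemma charge_finite g A : diffuse_charge g -> finite_set A -> g A = 0.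
Proof.
move=> cg /finite_seqP[s ->]; have [g0 _ g1] := cg.
elim: s => [|n s IH]; first by rewrite set_nil charge0.
have -> : [set` n :: s] = [set n] `|` [set` s].
  by apply/seteqP; split=> k /=; rewrite inE => /predU1P.
apply/eqP; rewrite eq_le g0 andbT.
by rewrite (le_trans (charge_leU _ _ cg))// IH g1 addr0.
Qed.

Let progression n r : set nat := [set (r + 2 ^ n * k)%N | k in setT].

Let progression_split n r :
  progression n r = progression n.+1 r `|` progression n.+1 (r + 2 ^ n).
Proof.
apply/seteqP; split=> k.
- move=> [j _ <-]; have := odd_double_half j; case: (odd j) => /= jE.
  + by right; exists j./2 => //; rewrite -{2}jE expnS; lia.
  + by left; exists j./2 => //; rewrite -{2}jE expnS; lia.
- move=> [] [j _ <-].
  + by exists j.*2 => //; rewrite expnS; lia.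
  + by exists j.*2.+1 => //; rewrite expnS; lia.
Qed.

Let progression_disj n r :
  progression n.+1 r `&` progression n.+1 (r + 2 ^ n) = set0.
Proof.
apply/seteqP; split=> // k [[i _ <-] [j _]] /eqP.
rewrite -addnA eqn_add2l expnS -!mulnA !(mulnCA 2 (2 ^ n)%N) -mulnS.
rewrite eqn_pmul2l ?expn_gt0//; lia.
Qed.

(** The progressions [r + 2 ^ n * k] split into two of modulus [2 ^ n.+1].
    Descending each time into the half of smaller charge gives a decreasing
    sequence of progressions whose charges tend to 0, and any infinite set that
    is almost contained in all of them is null. *)
Lemma exists_infinite_charge0 g : diffuse_charge g ->
  exists2 B : set nat, forall n, exists2 k, (n <= k)%N & B k & g B = 0.
Proof.
move=> cg; have [g_ge0 gU _] := cg.
pose lighter n r :=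
  if g (progression n.+1 r) <= g (progression n.+1 (r + 2 ^ n)) then r
  else (r + 2 ^ n)%N.
pose r := fix r n := if n is n'.+1 then lighter n' (r n') else 0%N.
have halve n : g (progression n (r n)) * 2 ^+ n <= g setT.
  elim: n => [|n]; first by rewrite mulr1; exact: charge_le.
  apply: le_trans; rewrite exprS mulrA ler_wpM2r ?exprn_ge0//=.
  rewrite (progression_split n (r n)) gU// /lighter.
  by case: ifP => [|/negbT]; [|rewrite -ltNge] => ?; lra.
have mono n m : (n <= m)%N -> progression n (r n) (r m).
  elim: m => [|m IH]; first by rewrite leqn0 => /eqP ->; exists 0%N.
  rewrite leq_eqVlt => /predU1P[->|].
    by exists 0%N; rewrite ?muln0 ?addn0.
  rewrite ltnS => nm; have [k _ kE] := IH nm.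
  rewrite /= /lighter; case: ifP => _; first by exists k.
  exists (k + 2 ^ (m - n))%N => //.
  by rewrite mulnDr -expnD subnKC// addnA kE.
(* The starting points [r n] alone might be eventually constant; adding [2 ^ n]
   stays in the progression and makes the set infinite. *)
pose B := [set (r n + 2 ^ n)%N | n in setT].
exists B.
  move=> n; exists (r n + 2 ^ n)%N; last by exists n.
  by rewrite (leq_trans (ltnW (ltn_expl n (isT : 1 < 2)%N)))// leq_addl.
have le_gB n : g B <= g (progression n (r n)).
  pose I := [set (r k + 2 ^ k)%N | k in `I_n].
  have -> : g (progression n (r n)) = g I + g (progression n (r n)).
    rewrite (@charge_finite _ I)// ?add0r//; exact/finite_image/finite_II.
  apply: le_trans (charge_leU _ _ cg); apply: charge_le => // _ [k _ <-].
  have [kn|nk] := ltnP k n; first by left; exists k.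
  right; have [j _ jE] := mono _ _ nk; exists (j + 2 ^ (k - n))%N => //.
  by rewrite mulnDr -expnD subnKC// addnA jE.
apply/eqP; rewrite eq_le g_ge0 andbT leNgt; apply/negP => gB0.
have [n] : exists n : nat, g setT / g B < n%:R.
  by exists (Num.bound (g setT / g B)); rewrite archi_boundP// divr_ge0.
rewrite ltr_pdivrMr// ltNge => /negP; apply.
apply: le_trans (halve n); rewrite mulrC.
apply: (le_trans _ (ler_wpM2r (exprn_ge0 n (ler0n R 2)) (le_gB n))).
by rewrite ler_wpM2l// -natrX ler_nat ltnW// ltn_expl.
Qed.

End diffuse_charge.

(** * Meager families of subsets of omega *)

Definition cylinder (A : set nat) (n : nat) : set powerset_omega :=
  [set B | forall i, (i < n)%N -> A i <-> B i].

(** The topology is transported from an infinite product; this is its concrete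
    form, and the only fact about it that the rest of the file uses. *)
Lemma nbhs_powersetP (A : powerset_omega) (X : set powerset_omega) :
  nbhs A X <-> exists n, cylinder A n `<=` X.
Proof.
split.
- move=> [_ [[V oV <-] /= VA] VX].
  (* The sets containing a cylinder form a filter that converges to [A] in
     every coordinate, hence in the product topology. *)
  pose F : set_system cantor_space :=
    [set Y | exists n, forall g : cantor_space,
       (forall i, (i < n)%N -> char_fun A i = g i) -> Y g].
  have FF : Filter F.
    split.
    + by exists 0%N.
    + move=> P Q [n nP] [m mQ]; exists (maxn n m) => g gA; split.
        by apply: nP => i im; apply: gA; rewrite leq_max im.
      by apply: mQ => i im; apply: gA; rewrite leq_max im orbT.
    + by move=> P Q PQ [n nP]; exists n => g /nP /PQ.
  have : F --> (char_fun A : cantor_space).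
    apply/cvg_sup => i Y [_ [[Z _ <-] /= ZA] ZY].
    exists i.+1 => g gA; apply: ZY => /=; rewrite /= -gA//.
  move=> /(_ V) []; first exact: open_nbhs_nbhs.
  move=> n nV; exists n => B AB; apply: VX; apply: nV => i /AB ABi.
  exact: asbool_equiv_eq.
- move=> [n nX]; apply: filterS nX _.
  elim: n => [|n IH]; first exact: (filterS _ filterT).
  have : nbhs A [set B : powerset_omega | char_fun B n = char_fun A n].
    have h : continuous (fun B : powerset_omega => char_fun B n).
      move=> B; apply: (@continuous_comp _ _ _
        (char_fun : powerset_omega -> cantor_space) (@proj nat (fun=> bool) n)).
        exact: initial_continuous.
      exact: proj_continuous.
    exact: (h A [set char_fun A n]).
  apply: filterS2 IH => B AB ABn i.
  rewrite ltnS leq_eqVlt => /predU1P[->|/AB//].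
  split=> /asboolP.
    by rewrite -[`[< _ >]]/(char_fun A n) -ABn => /asboolP.
  by rewrite -[`[< _ >]]/(char_fun B n) ABn => /asboolP.
Qed.

Lemma nowhere_dense_cylinder (N : set powerset_omega) (A : set nat) n :
  nowhere_dense N ->
  exists B m, [/\ (n <= m)%N, cylinder A n B & cylinder B m `<=` ~` N].
Proof.
move=> N0.
have : ~ cylinder A n `<=` closure N.
  move=> AN; suff : (interior (closure N)) A by rewrite N0.
  by apply/nbhs_powersetP; exists n.
move=> /existsNP[B /not_implyP[AB]].
move=> /existsNP[X /not_implyP[/nbhs_powersetP[m mX]]] NX.
exists B, (maxn n m); split=> //; first exact: leq_maxl.
move=> C BC NC; apply: NX; exists C; split=> //; apply: mX => i im.
by apply: BC; rewrite leq_max im orbT.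
Qed.

(** One pattern [z] on the places from [n] to [m - 1] works for finitely many
    pairs of a prefix of length [n] and a nowhere dense set: the pairs are
    treated one after the other, each time prolonging the pattern found so
    far. *)
Lemma avoid_prefixes (n : nat) (L : seq (seq bool * set powerset_omega)) :
  (forall p, p \in L -> nowhere_dense p.2) ->
  exists z m, (n <= m)%N /\ forall p, p \in L -> forall C : set nat,
    (forall i, (i < n)%N -> nth false p.1 i <-> C i) ->
    (forall i, (n <= i < m)%N -> z i <-> C i) -> ~ p.2 C.
Proof.
elim: L => [|[s N] L IH] nwd; first by exists set0, n.
have [|z [m [nm avoid]]] := IH.
  by move=> p pL; apply: nwd; rewrite inE pL orbT.
pose A := [set i | if (i < n)%N then nth false s i : Prop else z i].
have [|B [m' [mm' AB BN]]] := @nowhere_dense_cylinder N A m.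
  by apply: (nwd (s, N)); rewrite inE eqxx.
exists B, m'; split; first exact: leq_trans mm'.
move=> p; rewrite inE => /predU1P[->{p}/= C sC BC|pL C sC BC].
- apply: BN => i im'; have [ni|ni] := leqP n i; first by apply: BC; rewrite ni.
  rewrite -sC// -AB; first by rewrite /A/= ni.
  exact: leq_trans nm.
- apply: avoid pL _ sC _ => i /andP[ni im]; rewrite -BC; last first.
    by rewrite ni (leq_trans im).
  by rewrite -AB// /A/= ltnNge ni.
Qed.

(** There are only finitely many prefixes of length [n], so a pattern on a block
    starting at [n] can avoid [N 0], ..., [N k] whatever precedes the block. *)
Lemma avoid_block (N : nat -> set powerset_omega) :
  (forall i, nowhere_dense (N i)) -> forall n k,
  exists zm : set nat * nat, (n <= zm.2)%N /\ forall C : set nat,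
    (forall i, (n <= i < zm.2)%N -> zm.1 i <-> C i) ->
    forall i, (i <= k)%N -> ~ N i C.
Proof.
move=> nwd n k.
pose L := [seq (val t, N i) | t <- enum {: n.-tuple bool}, i <- iota 0 k.+1].
have [|z [m [nm avoid]]] := @avoid_prefixes n L.
  by move=> _ /allpairsP[[t i] /= [_ _ ->]]; exact: nwd.
exists (z, m); split=> // C zC i ik.
pose t := [tuple of mkseq (fun i => `[< C i >]) n].
apply: (avoid (val t, N i)) => //.
  apply/allpairsP; exists (t, i); split=> //=; first by rewrite mem_enum.
  by rewrite -[_ :: _]/(iota 0 k.+1) mem_iota.
by move=> j jn; rewrite nth_mkseq//; split=> /asboolP.
Qed.

Definition block (c : nat -> nat) (k : nat) : set nat :=
  [set i | (c k <= i < c k.+1)%N].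

Lemma block_inj c i j k : {homo c : m n / (m <= n)%N} ->
  block c i k -> block c j k -> i = j.
Proof.
move=> c_mono /andP[ik ki] /andP[jk kj].
have [ij|ji|//] := ltngtP i j.
- by have := leq_trans (leq_trans ki (c_mono _ _ ij)) jk; rewrite ltnn.
- by have := leq_trans (leq_trans kj (c_mono _ _ ji)) ik; rewrite ltnn.
Qed.

(** One direction of the characterization of meager filters due to Talagrand and
    Jalali-Naini. A set that copies the avoiding patterns [z] on infinitely
    many blocks lies in no [N n]. If a member of [F] missed infinitely many
    blocks, adding [z] on those blocks would enlarge it to such a set. *)
Lemma meager_upclosed_blocks (F : set powerset_omega) : meager F ->
  (forall A B : set nat, A `<=` B -> F A -> F B) ->
  exists2 c : nat -> nat, {homo c : m n / (m <= n)%N} &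
    forall I : set nat, (forall n, exists2 k, (n <= k)%N & I k) ->
      ~ F (~` \bigcup_(k in I) block c k).
Proof.
move=> [N nwd ->] upF.
have [next nextP] := choice (fun p : nat * nat => avoid_block nwd p.1 p.2).
pose c := fix c k := if k is k'.+1 then (next (c k', k')).2 else 0%N.
pose z k := (next (c k, k)).1.
have c_mono : {homo c : m n / (m <= n)%N}.
  apply: homo_leq => [//|? ? ?|k]; first exact: leq_trans.
  exact: (nextP (c k, k)).1.
exists c => // I I_inf FI.
pose C : set nat := ~` (\bigcup_(k in I) block c k) `|`
  \bigcup_(k in I) (block c k `&` z k).
have [j _ NjC] : (\bigcup_n N n) C by apply: upF FI => k; left.
have [k jk Ik] := I_inf j.
apply: ((nextP (c k, k)).2 C) jk NjC => i cki; split=> [zi|].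
  by right; exists k.
move=> [nI|[k' _ [ck'i]]]; first by exfalso; apply: nI; exists k.
by rewrite (block_inj c_mono ck'i cki).
Qed.

(** * Universally measurable sets and binary digits *)

(** The image under [g] of [P] restricted to [D], defined on the largest
    possible sigma-algebra [S], is complete because [P] is. Restricting to a
    set of finite measure is what makes the image sigma-finite. *)
Lemma universally_measurable_preimage d (X : measurableType d) (R : realType)
    (P : {measure set X -> \bar R}) (T : ptopologicalType) (D : set X)
    (g : X -> T) (A : set T) :
  measure_is_complete P -> measurable D -> (P D < +oo)%E ->
  (forall U, open U -> measurable (D `&` g @^-1` U)) ->
  universally_measurable R A -> measurable (D `&` g @^-1` A).
Proof.
move=> cP mD PD mg umA.
pose S : set_system T := [set B | measurable (D `&` g @^-1` B)].
have S_sigma : sigma_algebra setT S.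
  split; rewrite /S/=.
  - by rewrite preimage_set0 setI0.
  - move=> B mB; rewrite setTD preimage_setC.
    have -> : D `&` ~` (g @^-1` B) = D `\` (D `&` g @^-1` B).
      by rewrite setDIr setDv set0U setDE.
    exact: measurableD.
  - move=> B mB; rewrite preimage_bigcup setI_bigcupr.
    exact: bigcupT_measurable.
have mS (B : set (g_sigma_algebraType S)) : measurable B = S B.
  by rewrite -[in RHS](sigma_algebra_id S_sigma).
pose mu (B : set (g_sigma_algebraType S)) : \bar R := P (D `&` g @^-1` B).
have mu0 : mu set0 = 0%E by rewrite /mu preimage_set0 setI0 measure0.
have mu_ge0 B : (0 <= mu B)%E by exact: measure_ge0.
have mu_sigma : semi_sigma_additive mu.
  move=> F mF tF _; rewrite /mu preimage_bigcup setI_bigcupr.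
  have mF' n : measurable (D `&` g @^-1` F n).
    by have := mF n; rewrite mS.
  apply: measure_semi_sigma_additive => //; last exact: bigcupT_measurable.
  apply/trivIsetP => i j _ _ ij; have /trivIsetP/(_ i j I I ij) FIJ := tF.
  by rewrite setIACA setIid -preimage_setI FIJ preimage_set0 setI0.
pose M : {measure set (g_sigma_algebraType S) -> \bar R} :=
  HB.pack mu (isMeasure.Build _ _ _ mu mu0 mu_ge0 mu_sigma).
apply: (umA S M) => //.
- move=> B [C [mC C0 BC]]; rewrite mS; apply: cP.
  exists (D `&` g @^-1` C); split=> //; first by rewrite mS in mC.
  by move=> x [Dx /BC].
- exists (fun=> setT); first by rewrite bigcup_const//; exists 0%N.
  move=> _; split; first exact: measurableT.
  by rewrite /M/= /mu preimage_setT setIT.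
Qed.

(** Open sets are countable unions of cylinders, since a cylinder is given by a
    finite sequence of booleans. *)
Lemma measurable_powerset_map d (X : measurableType d)
    (g : X -> powerset_omega) :
  (forall n, measurable [set x | g x n]) ->
  forall U, open U -> measurable (g @^-1` U).
Proof.
move=> mg U oU.
pose cyl (s : seq bool) : set powerset_omega :=
  [set A | forall i, (i < size s)%N -> nth false s i <-> A i].
have mcyl s : measurable (g @^-1` cyl s).
  pose G i := [set x | (i < size s)%N -> nth false s i <-> g x i].
  have -> : g @^-1` cyl s = \bigcap_i G i.
    by apply/seteqP; split=> [x gx i _|x gx i]; [exact: gx|exact: (gx i I)].
  apply: bigcapT_measurable => i; rewrite /G.
  case: (i < size s)%N; last first.
    by rewrite (_ : [set _ | _] = setT)//; apply/seteqP.
  case: (nth false s i).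
    rewrite (_ : [set _ | _] = [set x | g x i])//.
    by apply/seteqP; split=> x /= h; [exact/(h isT)|split].
  rewrite (_ : [set _ | _] = ~` [set x | g x i]); first exact: measurableC.
  apply/seteqP; split=> x /=; first by move=> /(_ isT) [_ h] /h.
  by move=> h _; split=> // /h.
have -> : U = \bigcup_s (if `[< cyl s `<=` U >] then cyl s else set0).
  apply/seteqP; split=> [A UA|A [s _]]; last by case: asboolP => // sU /sU.
  have /nbhs_powersetP[n nU] : nbhs A U by exact: open_nbhs_nbhs.
  pose s := mkseq (fun i => `[< A i >]) n.
  have sE (B : set nat) : cyl s B <-> cylinder A n B.
    rewrite /cyl /cylinder/= size_mkseq; split=> AB i ni.
      by have := AB i ni; rewrite nth_mkseq// => <-; split=> /asboolP.
    by rewrite nth_mkseq// -AB//; split=> /asboolP.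
  exists s => //; case: asboolP; first by move=> _; exact/sE.
  by case; move=> B /sE; exact: nU.
rewrite preimage_bigcup; apply: countable_bigcupT_measurable => // s.
by case: asboolP => _; rewrite ?preimage_set0.
Qed.

Section binary_digits.
Variable R : realType.

(** The parity of the integer part of [2 ^+ n * x] is the binary digit of [x] of
    weight [2 ^- n]; for negative [x] this is the two's complement expansion. *)
Definition binary_digits (x : R) : set nat :=
  [set n | ~~ (2 %| Num.floor (2 ^+ n * x))%Z].

Definition dyadic : set R :=
  [set j%:~R / 2 ^+ m | j in [set: int] & m in [set: nat]].

Lemma measurable_binary_digit n :
  @measurable _ (measurableTypeR R) [set x | binary_digits x n].
Proof.
have -> : [set x | binary_digits x n] = \bigcup_(j : int)
    if (2 %| j)%Z then set0
    else `[j%:~R / 2 ^+ n, (j + 1)%:~R / 2 ^+ n[%classic.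
  have h (x : R) j : `[j%:~R / 2 ^+ n, (j + 1)%:~R / 2 ^+ n[%classic x
      = (Num.floor (2 ^+ n * x) == j) :> Prop.
    by rewrite floor_eq /= in_itv/= ler_pdivrMr ?ltr_pdivlMr ?exprn_gt0// mulrC.
  apply/seteqP; split=> x /=.
    move=> xn; exists (Num.floor (2 ^+ n * x)) => //.
    by move: xn; rewrite /binary_digits/=; case: ifP => // _ _; rewrite h.
  move=> [j _]; rewrite /binary_digits/=; case: ifP => // jo.
  by rewrite h => /eqP ->; rewrite jo.
by apply: countable_bigcupT_measurable => // j; case: ifP.
Qed.

Lemma countable_dyadic : countable dyadic.
Proof.
have -> : dyadic = [set p.1%:~R / 2 ^+ p.2 | p in [set: int * nat]].
  apply/seteqP; split=> [_ [j _ [m _ <-]]|_ [[j m] _ <-]].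
    by exists (j, m).
  by exists j => //; exists m.
exact/(sub_countable (card_image_le _ _))/countableP.
Qed.

(** For [n] beyond [m], scaling by [2 ^+ n] turns the reflection into the
    subtraction of [2 ^+ n * x] from an even integer, and the integer parts of
    [y] and [- y] add up to [-1] unless [y] is an integer. *)
Lemma binary_digits_reflect (c : int) (m : nat) (x : R) n :
  ~ dyadic x -> (m < n)%N ->
  binary_digits (c%:~R / 2 ^+ m - x) n <-> ~ binary_digits x n.
Proof.
move=> xND mn; rewrite /binary_digits/=; set f := Num.floor (2 ^+ n * x).
have -> : Num.floor (2 ^+ n * (c%:~R / 2 ^+ m - x)) = c * 2 ^+ (n - m) - f - 1.
  apply: floor_def.
  have e : 2 ^+ n * (c%:~R / 2 ^+ m - x)
      = (c * 2 ^+ (n - m))%:~R - 2 ^+ n * x :> R.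
    rewrite mulrBr; congr (_ - _).
    rewrite -(subnK (ltnW mn)) addnK exprD intrM rmorphXn/= mulrC.
    by rewrite -!mulrA; congr (_ * _); rewrite mulrC mulfK// expf_neq0.
  have := floor_itv (2 ^+ n * x); rewrite -/f e => /andP[fx xf].
  have fNx : f%:~R != 2 ^+ n * x.
    apply: contra_notN xND => /eqP fx'; exists f => //; exists n => //.
    by rewrite fx' mulrC mulKf// expf_neq0.
  have {fx fNx} : f%:~R < 2 ^+ n * x by rewrite lt_neqAle fNx.
  move: xf; rewrite !(intrD, intrB, intrN) /=; lra.
have : (2 %| c * 2 ^+ (n - m))%Z.
  by rewrite -(subnSK mn) exprS mulrCA dvdz_mulr.
lia.
Qed.

End binary_digits.

(** * Nonmeasurability of ultrafilters *)

Section lebesgue_outer.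
Variable R : realType.
Local Notation lam := (wlength (@idfun R))^*%mu.
Implicit Types (E X : set R) (W : set (set nat)).

(** On all sets [lam] is the outer measure from which Lebesgue measure is
    obtained by restriction. *)
Lemma outer_itv (i : interval R) : lam [set` i] =
  (if (i.1 < i.2)%E then ((i.2 : \bar R) - i.1)%E else 0%E).
Proof. exact: lebesgue_measure_itv. Qed.

Lemma outer_dyadic : lam (@dyadic R) = 0%E.
Proof. exact/countable_lebesgue_measure0/countable_dyadic. Qed.

(** A reflected cover no longer consists of intervals open on the left and
    closed on the right, so it does not compete in the infimum that defines
    [lam]; countable subadditivity and the value of [lam] on intervals replace
    this. *)
Lemma outer_reflect (c : R) X : (lam ((fun x => (c - x)%R) @^-1` X) <= lam X)%E.
Proof.
apply: le_ereal_inf_tmp => _ [A [mA XA] <-].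
pose r (x : R) := c - x.
apply: (@le_trans _ _ (lam (\bigcup_k (r @^-1` A k)))).
  by apply: le_outer_measure => x /XA [k _ Ak]; exists k.
apply: (le_trans (outer_measure_sigma_subadditive _ _)).
apply: lee_nneseries => [k _ _|k _]; first exact: outer_measure_ge0.
have /ocitvP[->|[[a b] /= ab AkE]] := mA k.
  by rewrite preimage_set0 outer_measure0.
rewrite -measurable_mu_extE; last exact: mA.
have -> : r @^-1` A k = `[c - b, c - a[%classic.
  rewrite AkE; apply/seteqP; split=> x; rewrite /r/= !in_itv/=; lra.
rewrite AkE !outer_itv/= !lte_fin ab ltrD2l ltrN2 ab.
by rewrite -!EFinB lee_fin; lra.
Qed.

Lemma dyadic_approx (a b e : R) : 0 < e -> exists (m : nat) (j k : int),
  [/\ j%:~R / 2 ^+ m <= a, b < k%:~R / 2 ^+ m &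
      k%:~R / 2 ^+ m - j%:~R / 2 ^+ m <= b - a + e].
Proof.
move=> e0; pose m := Num.bound (2 / e).
have m2 : 2 / e < 2 ^+ m.
  apply: (@lt_trans _ _ m%:R); first by rewrite archi_boundP// divr_ge0 ?ltW.
  by rewrite -natrX ltr_nat ltn_expl.
have p0 : 0 < 2 ^+ m :> R by rewrite exprn_gt0.
have {}m2 : 2 / 2 ^+ m < e by rewrite ltr_pdivrMr// mulrC -ltr_pdivrMr.
exists m, (Num.floor (2 ^+ m * a)), (Num.floor (2 ^+ m * b) + 1).
have /andP[a1 a2] := floor_itv (2 ^+ m * a).
have /andP[b1 b2] := floor_itv (2 ^+ m * b).
split.
- by rewrite ler_pdivrMr// (mulrC a).
- by rewrite ltr_pdivlMr// (mulrC b).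
- rewrite -mulrBl ler_pdivrMr// mulrDl; move: m2; rewrite ltr_pdivrMr//.
  move: a1 a2 b1 b2; rewrite !intrD; nra.
Qed.

(** An interval [J] with dyadic endpoints is invariant under the reflection
    about its midpoint. For [x] in [E] not dyadic, the digits of the reflection
    of [x] differ only finitely from the complement of those of [x], so the
    reflection is outside [E]: the part of [J] in [E] is not larger than the
    part outside, and measurability of [E] adds the two parts up to [J]. Other
    intervals are approximated by dyadic ones. *)
Lemma reflection_half W (E := [set x : R | W (binary_digits x)]) :
  (forall A B m, (forall n, (m < n)%N -> A n <-> B n) -> W A -> W B) ->
  (forall A, W A -> ~ W (~` A)) ->
  lam.-caratheodory E -> forall a b : R, a < b ->
  (lam (E `&` `]a, b]) + lam (E `&` `]a, b]) <= (b - a)%:E)%E.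
Proof.
move=> Wfin WC mE a b ab; apply/lee_addgt0Pr => e e0.
have [m [j [k [ja bk jk]]]] := dyadic_approx a b e0.
set a' := _ / _ in ja jk; set b' := _ / _ in bk jk.
pose J : set R := `]a', b'[%classic.
have lamJ : lam J = (b' - a')%:E.
  by rewrite /J outer_itv/= lte_fin (le_lt_trans ja)// (lt_trans ab).
have subJ : `]a, b]%classic `<=` J.
  move=> x; rewrite /J/= !in_itv/= => /andP[ax xb].
  by rewrite (le_lt_trans ja ax) (le_lt_trans xb bk).
have half : (lam (J `&` E) <= lam (J `&` ~` E))%E.
  pose c := (j + k)%:~R / 2 ^+ m : R.
  have cE : c = a' + b' by rewrite /c intrD mulrDl.
  apply: (@le_trans _ _
      (lam ((fun x => (c - x)%R) @^-1` (J `&` ~` E) `|` @dyadic R))).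
    apply: le_outer_measure => x [Jx Ex].
    have [xD|xND] := pselect (dyadic x); [by right|left; split].
      by move: Jx; rewrite /J/= !in_itv/= cE; lra.
    move=> Er; apply: (WC _ Ex); apply: (Wfin _ _ m _ Er) => n mn.
    exact: (binary_digits_reflect _ xND mn).
  apply: (le_trans (outer_measureU2 _ _ _)).
  rewrite -[leRHS]adde0; apply: leeD; first exact: outer_reflect.
  by rewrite le_eqVlt; apply/orP; left; apply/eqP; exact: outer_dyadic.
apply: (@le_trans _ _ (lam J)); last by rewrite lamJ -EFinD lee_fin.
rewrite (mE J); apply: leeD.
  by apply: le_outer_measure; rewrite setIC; exact: setSI.
apply: le_trans half; apply: le_outer_measure; rewrite setIC; exact: setSI.
Qed.

(** Covering [Y] by intervals shows that [E] fills at most half of every set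
    [Y]; applied to a part of [E] of finite measure, this shows that the part
    is null. *)
Lemma half_null E X :
  (forall a b : R, a < b ->
    (lam (E `&` `]a, b]) + lam (E `&` `]a, b]) <= (b - a)%:E)%E) ->
  (lam X < +oo)%E -> lam (E `&` X) = 0%E.
Proof.
move=> half Xfin.
have le_half Y : (lam (E `&` Y) + lam (E `&` Y) <= lam Y)%E.
  apply: le_ereal_inf_tmp => _ [A [mA YA] <-].
  apply: (@le_trans _ _ (\sum_(k <oo) (lam (E `&` A k) + lam (E `&` A k)))%E).
    have sub : (lam (E `&` Y) <= \sum_(k <oo) lam (E `&` A k))%E.
      apply: le_trans (outer_measure_sigma_subadditive _ _).
      by rewrite -setI_bigcupr; apply: le_outer_measure; exact: setIS.
    by rewrite nneseriesD ?leeD// => *; exact: outer_measure_ge0.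
  apply: lee_nneseries => [k _ _|k _].
    by apply: adde_ge0; exact: outer_measure_ge0.
  rewrite -measurable_mu_extE; last exact: mA.
  have /ocitvP[->|[[a b] /= ab ->]] := mA k.
    by rewrite setI0 outer_measure0 adde0.
  by rewrite outer_itv/= lte_fin ab -EFinB half.
have := le_half (E `&` X); rewrite setIA setIid.
have : lam (E `&` X) \is a fin_num.
  rewrite ge0_fin_numE ?outer_measure_ge0//.
  by apply: le_lt_trans Xfin; apply: le_outer_measure; exact: subIsetr.
have : (0 <= lam (E `&` X))%E := outer_measure_ge0 _ _.
case: (lam _) => // v v0 _ vv; congr EFin.
by move: v0 vv; rewrite !lee_fin; lra.
Qed.

(** [W] need not be a filter: it only has to contain exactly one of each set and
    its complement and to ignore finite changes. Then the hypotheses of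
    [reflection_half] hold for [W] and for the family complementary to [W], so
    both [E] and its complement would be null in [(0, 1]]. *)
Theorem ultrafilter_nonmeasurable W (E := [set x : R | W (binary_digits x)]) :
  (forall A B m, (forall n, (m < n)%N -> A n <-> B n) -> W A -> W B) ->
  (forall A, W A <-> ~ W (~` A)) -> ~ lam.-caratheodory E.
Proof.
move=> Wfin WC mE.
pose W' : set (set nat) := [set A | ~ W A].
have null F : (forall a b : R, a < b ->
    (lam (F `&` `]a, b]) + lam (F `&` `]a, b]) <= (b - a)%:E)%E) ->
    lam (F `&` `]0, 1]) = 0%E.
  move=> /half_null; apply.
  by rewrite outer_itv/= lte_fin ltr01 -EFinB ltry.
have E0 : lam (E `&` `]0, 1]) = 0%E.
  by apply/null/reflection_half => // A /WC.
have CE0 : lam (~` E `&` `]0, 1]) = 0%E.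
  apply/null; apply: (@reflection_half W') => [A B m AB WA WB|A WA|].
  - by apply: WA; apply: Wfin WB => n /AB [].
  - by move=> nWC; apply: WA; apply/WC.
  - exact: (caratheodory_measurable_setC mE).
have := mE `]0, 1]%classic.
rewrite setIC E0 setIC CE0 outer_itv/= lte_fin ltr01 add0e -EFinB => -[].
lra.
Qed.

End lebesgue_outer.

(** * Medial limits *)

Section medial_limit.
Variables (R : realType) (f : powerset_omega -> R).
Hypothesis medial_f : medial_limit f.

Definition full_sets : set_system nat := [set A | f A = 1].

Let charge_f : diffuse_charge f.
Proof.
by have [f01 _ fU f1 _] := medial_f; split=> // A; case/andP: (f01 A).
Qed.

Lemma full_setsC (A : set nat) : full_sets A <-> f (~` A) = 0.
Proof.
have [_ _ fU _ fT] := medial_f.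
have := fU A (~` A) (setICr A); rewrite setUCr fT /full_sets/=.
by split=> ?; lra.
Qed.

Lemma full_sets_up (A B : set nat) : A `<=` B -> full_sets A -> full_sets B.
Proof.
move=> AB fA; have [f01 _ _ _ _] := medial_f.
apply/eqP; rewrite /= eq_le; case/andP: (f01 B) => _ -> /=.
by rewrite -fA; exact: (charge_le charge_f).
Qed.

Lemma full_sets_cofinite (A : set nat) : finite_set (~` A) -> full_sets A.
Proof. by move=> finA; apply/full_setsC; exact: charge_finite. Qed.

Lemma full_sets_uniform : uniform_filter full_sets.
Proof.
have [f01 _ fU _ fT] := medial_f; split; last exact: full_sets_cofinite.
split.
  by rewrite /full_sets/= (charge0 charge_f) => /eqP; rewrite eq_sym oner_eq0.
split=> // [A B /full_setsC fA /full_setsC fB|A B]; last exact: full_sets_up.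
apply/full_setsC; rewrite setCI; apply/eqP; rewrite eq_le.
rewrite (le_trans (charge_leU _ _ charge_f)) ?fA ?fB ?addr0//.
by case/andP: (f01 (~` A `|` ~` B)).
Qed.

(** If the filter were meager, [f] would give positive value to every union of
    infinitely many blocks ([meager_upclosed_blocks]). Then the charge [g] that
    it induces on sets of blocks would vanish on no infinite set, against
    [exists_infinite_charge0]. *)
Lemma full_sets_nonmeager : ~ meager (full_sets : set powerset_omega).
Proof.
have [f01 _ fU _ _] := medial_f.
move=> /meager_upclosed_blocks/(_ full_sets_up)[c c_mono avoid].
pose g (I : set nat) := f (\bigcup_(k in I) block c k).
have [|I I_inf gI0] := @exists_infinite_charge0 _ g.
  split=> [I|I J IJ0|k].
  - by case/andP: (f01 (\bigcup_(k in I) block c k)).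
  - rewrite /g bigcup_setU fU//.
    apply/seteqP; split=> // i [[k Ik ki] [l Jl li]].
    have : (I `&` J) k by split; rewrite // (block_inj c_mono ki li).
    by rewrite IJ0.
  - rewrite /g bigcup_set1; apply: charge_finite charge_f _.
    apply: (sub_finite_set _ (finite_II (c k.+1))).
    by move=> i /andP[].
by apply: (avoid I I_inf); apply/full_setsC; rewrite setCK.
Qed.

(** Every member of the image filter has a preimage of [f]-value 1, so [W] below
    contains the ultrafilter; additivity prevents it from containing both a
    set and its complement, and finiteness of the fibres of [h] makes it
    insensitive to finite changes. *)
Lemma full_sets_no_ultra_image (h : nat -> nat) : finite_to_one h ->
  ~ UltraFilter [set h @` A | A in full_sets].
Proof.
move=> h_fin ultra; have [_ um_f fU _ fT] := medial_f.
pose W : set (set nat) := [set A | full_sets (h @^-1` A)].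
have W_image A : [set h @` B | B in full_sets] A -> W A.
  move=> [B fB <-]; apply: full_sets_up fB; exact: preimage_image.
have WC A : W A <-> ~ W (~` A).
  split=> [WA WCA|nWCA].
    have fCA : f (h @^-1` (~` A)) = 0 := (full_setsC _).1 WA.
    by move: WCA; rewrite /W /full_sets/= fCA => /eqP; rewrite eq_sym oner_eq0.
  by have [/W_image|/W_image] := in_ultra_setVsetC A ultra.
have Wfin A B m : (forall n, (m < n)%N -> A n <-> B n) -> W A -> W B.
  move=> AB /full_setsC WA; apply/full_setsC/eqP.
  have [f_ge0 _ _] := charge_f; rewrite eq_le f_ge0 andbT.
  apply: (@le_trans _ _ (f (~` (h @^-1` A) `|` h @^-1` `I_m.+1))).
    apply: (charge_le charge_f) => i /= Bhi.
    have [hi|hi] := leqP (h i) m; first by right.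
    by left => /(AB _ hi).
  rewrite (le_trans (charge_leU _ _ charge_f))// WA add0r.
  rewrite (charge_finite charge_f)//.
  rewrite (_ : _ @^-1` _ = \bigcup_(n in `I_m.+1) h @^-1` [set n]).
    by apply: bigcup_finite => //; exact: finite_II.
  by apply/seteqP; split=> [i hi|i [n nm /= ->]//]; exists (h i).
apply: (@ultrafilter_nonmeasurable R W Wfin WC).
set E := [set x | _].
pose g (x : R) : powerset_omega := h @^-1` binary_digits x.
have mg U : open U -> (wlength (@idfun R))^*%mu.-cara.-measurable (g @^-1` U).
  apply: measurable_powerset_map => n; apply: sub_caratheodory.
  exact: measurable_binary_digit.
(* Measurability of [E] is proved on pieces of finite measure, as
   [universally_measurable_preimage] requires. *)
pose D (n : nat) : set R := `]- n%:R, n%:R]%classic.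
have mD n : (wlength (@idfun R))^*%mu.-cara.-measurable (D n).
  by apply: caratheodory_measurable_mu_ext; exact: is_ocitv.
have mED n : (wlength (@idfun R))^*%mu.-cara.-measurable (D n `&` E).
  have -> : D n `&` E = D n `\` (D n `&` g @^-1` (f @^-1` (~` [set 1]))).
    apply/seteqP; split=> x [Dx]; first by move=> Ex; split=> // -[_]; apply.
    move=> nEx; split=> //; apply: contrapT => Ex; exact: nEx.
  apply: measurableD => //.
  apply: (@universally_measurable_preimage _ _ R
    (@completed_lebesgue_measure R)) => //.
  - exact: completed_lebesgue_measure_is_complete.
  - rewrite [X in (X < _)%E]outer_itv/=; case: ifP => // _.
    by rewrite -EFinB ltry.
  - by move=> U oU; apply: measurableI => //; exact: mg.
  - by apply: um_f; rewrite openC; exact: closed_eq.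
suff -> : E = \bigcup_n (D n `&` E) by exact: bigcupT_measurable mED.
rewrite -setI_bigcupl (_ : \bigcup_n D n = setT) ?setTI//.
exact: bigcup_itvT.
Qed.

End medial_limit.

Theorem mainTheorem1 (R : realType) :
  filter_dichotomy -> ~ exists f : powerset_omega -> R, medial_limit f.
Proof.
move=> dichotomy [f medial_f].
have [h h_fin ultra] :=
  dichotomy _ (full_sets_uniform medial_f) (full_sets_nonmeager medial_f).
exact: (full_sets_no_ultra_image medial_f h_fin ultra).
Qed.
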